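(* Consider the $D_4^{(1)}$ system (defined in the context) restricted to parameters with $\alpha_4=\alpha_1$ and $\alpha_0=\alpha_3$, and set $\beta_0:=\alpha_3$, $\beta_1:=\alpha_2$, $\beta_2:=\alpha_1$, so that $\beta_0+\beta_1+\beta_2=\frac12$. This system admits the affine Weyl group symmetry of type $D_3^{(2)}$ as the group of its Bäcklund transformations, whose generators are explicitly given as follows, with the notation $( * ):=(x,y,z;\beta_0,\beta_1,\beta_2)$: $$\begin{aligned} s_0:( * )&\rightarrow\left(x,y,z-\tfrac{\beta_0(x+y-\eta-1)}{(x-\eta)(y-1)};-\beta_0,\beta_1+2\beta_0,\beta_2\right),\\ s_1:( * )&\rightarrow\left(x+\tfrac{\beta_1}{z},y+\tfrac{\beta_1}{z},z;\beta_0+\beta_1,-\beta_1,\beta_2+\beta_1\right),\\ s_2:( * )&\rightarrow\left(x,y,z-\tfrac{\beta_2(x+y)}{xy};\beta_0,\beta_1+2\beta_2,-\beta_2\right). \end{aligned}$$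
   Context: A Bäcklund transformation of a parametrized system is a birational transformation of the variables and parameters that takes the system with the original parameters to the system of the same form with the transformed parameters (here $\eta$ and $b(t)$ are unchanged). Affine Weyl group symmetry of type $D_3^{(2)}$ means that each $s_i$ is a Bäcklund transformation and that the $s_i$ satisfy the fundamental relations of the affine Weyl group of type $D_3^{(2)}$: $s_i^2=1$, $(s_0s_1)^4=(s_1s_2)^4=1$, $(s_0s_2)^2=1$. The $D_4^{(1)}$ system. Let $\eta\in\mathbb{C}\setminus\{0\}$, let $b(t)\in\mathbb{C}(t)$ be nonzero, and let $\alpha_0,\dots,\alpha_4\in\mathbb{C}$ satisfy $\alpha_0+\alpha_1+2\alpha_2+\alpha_3+\alpha_4=1$. The $D_4^{(1)}$ system for unknown functions $x,y,z$ of $t$ is $$\frac{2\eta}{b(t)}\frac{dx}{dt}=P,\qquad -\frac{2\eta}{b(t)}\frac{dy}{dt}=Q,\qquad \frac{2\eta}{b(t)}\frac{dz}{dt}=R,$$ where $P=-2x(y-1)yz(x-\eta)(2x-2y+1-\eta)-2(2\alpha_0+2\alpha_1+4\alpha_2+\alpha_3+\alpha_4)x^3y-2(\alpha_0+\alpha_1)xy^3+(5\alpha_0+5\alpha_1+6\alpha_2+\alpha_3+\alpha_4)x^2y^2-\{5\alpha_0+5\alpha_1+6\alpha_2+2\alpha_3-3(2\alpha_0+2\alpha_1+4\alpha_2+\alpha_3+\alpha_4)\eta\}x^2y+\{3(\alpha_0+\alpha_1)-(4\alpha_0+6\alpha_1+6\alpha_2+\alpha_3+\alpha_4)\eta\}xy^2+x^4+2(\alpha_0+\alpha_1+2\alpha_2+\alpha_3-\eta)x^3+2\alpha_1\eta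 y^3+\{(\alpha_0+\alpha_1+2\alpha_2+\alpha_3)(\eta^2-3\eta+1)+\alpha_4\eta^2\}x^2+\alpha_1(\eta-3)\eta y^2+\{-(\alpha_0+\alpha_1)+2(2\alpha_0+3\alpha_1+3\alpha_2+\alpha_3)\eta-(2\alpha_0+2\alpha_1+4\alpha_2+\alpha_3+\alpha_4)\eta^2\}xy+(\alpha_0+\alpha_1+2\alpha_2+\alpha_3)(\eta-1)\eta x-\alpha_1(\eta-1)\eta y$, $Q=2x(y-1)yz(x-\eta)(2x-2y+1-\eta)-2(\alpha_3+\alpha_4)x^3y-2(\alpha_0+\alpha_1+4\alpha_2+2\alpha_3+2\alpha_4)xy^3+(\alpha_0+\alpha_1+6\alpha_2+5\alpha_3+5\alpha_4)x^2y^2+\{-(\alpha_0+\alpha_1+6\alpha_2+4\alpha_3+6\alpha_4)+3(\alpha_3+\alpha_4)\eta\}x^2y+\{3(\alpha_0+\alpha_1+4\alpha_2+2\alpha_3+2\alpha_4)-(2\alpha_0+6\alpha_2+5\alpha_3+5\alpha_4)\eta\}xy^2+y^4+2\alpha_4x^3+2\{(\alpha_0+2\alpha_2+\alpha_3+\alpha_4)\eta-1\}y^3-\alpha_4(3\eta-1)x^2+\{1-3(\alpha_0+2\alpha_2+\alpha_3+\alpha_4)\eta+(\alpha_0+2\alpha_2+\alpha_3+\alpha_4)\eta^2\}y^2+\{-(\alpha_0+\alpha_1+4\alpha_2+2\alpha_3+2\alpha_4)+2(\alpha_0+3\alpha_2+2\alpha_3+3\alpha_4)\eta-(\alpha_3+\alpha_4)\eta^2\}xy+\alpha_4(\eta-1)\eta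 x-(\alpha_0+2\alpha_2+\alpha_3+\alpha_4)(\eta-1)\eta y$, $R=(2x-2y+1-\eta)\{2x^2y+2xy^2-x^2-\eta y^2-2(\eta+1)xy+\eta(x+y)\}z^2+z\big[-2(\alpha_3+\alpha_4)x^3+2(\alpha_0+\alpha_1)y^3+2(\alpha_0+\alpha_1+6\alpha_2+2\alpha_3+2\alpha_4)x^2y-2(2\alpha_0+2\alpha_1+6\alpha_2+\alpha_3+\alpha_4)xy^2+\{-(\alpha_0+\alpha_1+6\alpha_2+4\alpha_3)+3(\alpha_3+\alpha_4)\eta\}x^2+\{-3(\alpha_0+\alpha_1)+(4\alpha_0+6\alpha_2+\alpha_3+\alpha_4)\eta\}y^2-4\{-(\alpha_0+\alpha_1+3\alpha_2+\alpha_3)+(\alpha_0+3\alpha_2+\alpha_3+\alpha_4)\eta\}xy+\{-(\alpha_0+\alpha_1+4\alpha_2+2\alpha_3)+2(\alpha_0+3\alpha_2+2\alpha_3)\eta-(\alpha_3+\alpha_4)\eta^2\}x+\{\alpha_0+\alpha_1-2(2\alpha_0+3\alpha_2+\alpha_3)\eta+(2\alpha_0+4\alpha_2+\alpha_3+\alpha_4)\eta^2\}y-(\alpha_0+2\alpha_2+\alpha_3)(\eta-1)\eta\big]+\alpha_2\big[(\alpha_0+\alpha_1+2\alpha_2-\alpha_3-\alpha_4)x^2+(\alpha_0+\alpha_1-2\alpha_2-\alpha_3-\alpha_4)y^2-2(\alpha_0+\alpha_1-\alpha_3-\alpha_4)xy+\{\alpha_0+\alpha_1-2\alpha_3-(2\alpha_0+2\alpha_2-\alpha_3-\alpha_4)\eta\}x+\{-\alpha_0-\alpha_1+2\alpha_2+2\alpha_3+(2\alpha_0-\alpha_3-\alpha_4)\eta\}y+(\eta-1)(\alpha_2+\alpha_3+(\alpha_0+\alpha_2)\eta)\big]$.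 *)

(* Defs.v *)
From HB Require Import structures.
From mathcomp Require Import all_boot all_order all_algebra.
From mathcomp Require Import generic_quotient.
From mathcomp Require Import complex.
From mathcomp Require Import reals.
From mathcomp Require Import mpoly.
From mathcomp Require Import ring.

Set Implicit Arguments.
Unset Strict Implicit.
Unset Printing Implicit Defensive.

Import Order.TTheory GRing.Theory Num.Theory.
Local Open Scope ring_scope.
Local Open Scope quotient_scope.

(* The D_4^(1) system over a field F with a map D in the role of d/dt.
   a = (alpha_0, ..., alpha_4) and u = (x, y, z). *)

Definition D4_P (F : comNzRingType) (eta : F) (a : 5.-tuple F) (u : 3.-tuple F)
    : F :=
  let: a0 := a`_0 in let: a1 := a`_1 in let: a2 := a`_2 in
  let: a3 := a`_3 in let: a4 := a`_4 in
  let: x := u`_0 in let: y := u`_1 in let: z := u`_2 in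
  - 2 * x * (y - 1) * y * z * (x - eta) * (2 * x - 2 * y + 1 - eta)
  - 2 * (2 * a0 + 2 * a1 + 4 * a2 + a3 + a4) * x ^+ 3 * y
  - 2 * (a0 + a1) * x * y ^+ 3
  + (5 * a0 + 5 * a1 + 6 * a2 + a3 + a4) * x ^+ 2 * y ^+ 2
  - (5 * a0 + 5 * a1 + 6 * a2 + 2 * a3
     - 3 * (2 * a0 + 2 * a1 + 4 * a2 + a3 + a4) * eta) * x ^+ 2 * y
  + (3 * (a0 + a1) - (4 * a0 + 6 * a1 + 6 * a2 + a3 + a4) * eta) * x * y ^+ 2
  + x ^+ 4
  + 2 * (a0 + a1 + 2 * a2 + a3 - eta) * x ^+ 3
  + 2 * a1 * eta * y ^+ 3
  + ((a0 + a1 + 2 * a2 + a3) * (eta ^+ 2 - 3 * eta + 1) + a4 * eta ^+ 2)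
    * x ^+ 2
  + a1 * (eta - 3) * eta * y ^+ 2
  + (- (a0 + a1) + 2 * (2 * a0 + 3 * a1 + 3 * a2 + a3) * eta
     - (2 * a0 + 2 * a1 + 4 * a2 + a3 + a4) * eta ^+ 2) * x * y
  + (a0 + a1 + 2 * a2 + a3) * (eta - 1) * eta * x
  - a1 * (eta - 1) * eta * y.

Definition D4_Q (F : comNzRingType) (eta : F) (a : 5.-tuple F) (u : 3.-tuple F)
    : F :=
  let: a0 := a`_0 in let: a1 := a`_1 in let: a2 := a`_2 in
  let: a3 := a`_3 in let: a4 := a`_4 in
  let: x := u`_0 in let: y := u`_1 in let: z := u`_2 in
  2 * x * (y - 1) * y * z * (x - eta) * (2 * x - 2 * y + 1 - eta)
  - 2 * (a3 + a4) * x ^+ 3 * y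
  - 2 * (a0 + a1 + 4 * a2 + 2 * a3 + 2 * a4) * x * y ^+ 3
  + (a0 + a1 + 6 * a2 + 5 * a3 + 5 * a4) * x ^+ 2 * y ^+ 2
  + (- (a0 + a1 + 6 * a2 + 4 * a3 + 6 * a4) + 3 * (a3 + a4) * eta) * x ^+ 2 * y
  + (3 * (a0 + a1 + 4 * a2 + 2 * a3 + 2 * a4)
     - (2 * a0 + 6 * a2 + 5 * a3 + 5 * a4) * eta) * x * y ^+ 2
  + y ^+ 4
  + 2 * a4 * x ^+ 3
  + 2 * ((a0 + 2 * a2 + a3 + a4) * eta - 1) * y ^+ 3
  - a4 * (3 * eta - 1) * x ^+ 2
  + (1 - 3 * (a0 + 2 * a2 + a3 + a4) * eta
     + (a0 + 2 * a2 + a3 + a4) * eta ^+ 2) * y ^+ 2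
  + (- (a0 + a1 + 4 * a2 + 2 * a3 + 2 * a4)
     + 2 * (a0 + 3 * a2 + 2 * a3 + 3 * a4) * eta
     - (a3 + a4) * eta ^+ 2) * x * y
  + a4 * (eta - 1) * eta * x
  - (a0 + 2 * a2 + a3 + a4) * (eta - 1) * eta * y.

Definition D4_R (F : comNzRingType) (eta : F) (a : 5.-tuple F) (u : 3.-tuple F)
    : F :=
  let: a0 := a`_0 in let: a1 := a`_1 in let: a2 := a`_2 in
  let: a3 := a`_3 in let: a4 := a`_4 in
  let: x := u`_0 in let: y := u`_1 in let: z := u`_2 in
  (2 * x - 2 * y + 1 - eta)
    * (2 * x ^+ 2 * y + 2 * x * y ^+ 2 - x ^+ 2 - eta * y ^+ 2
       - 2 * (eta + 1) * x * y + eta * (x + y)) * z ^+ 2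
  + z * (- 2 * (a3 + a4) * x ^+ 3 + 2 * (a0 + a1) * y ^+ 3
         + 2 * (a0 + a1 + 6 * a2 + 2 * a3 + 2 * a4) * x ^+ 2 * y
         - 2 * (2 * a0 + 2 * a1 + 6 * a2 + a3 + a4) * x * y ^+ 2
         + (- (a0 + a1 + 6 * a2 + 4 * a3) + 3 * (a3 + a4) * eta) * x ^+ 2
         + (- 3 * (a0 + a1) + (4 * a0 + 6 * a2 + a3 + a4) * eta) * y ^+ 2
         - 4 * (- (a0 + a1 + 3 * a2 + a3) + (a0 + 3 * a2 + a3 + a4) * eta)
           * x * y
         + (- (a0 + a1 + 4 * a2 + 2 * a3) + 2 * (a0 + 3 * a2 + 2 * a3) * eta
            - (a3 + a4) * eta ^+ 2) * x
         + (a0 + a1 - 2 * (2 * a0 + 3 * a2 + a3) * eta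
            + (2 * a0 + 4 * a2 + a3 + a4) * eta ^+ 2) * y
         - (a0 + 2 * a2 + a3) * (eta - 1) * eta)
  + a2 * ((a0 + a1 + 2 * a2 - a3 - a4) * x ^+ 2
          + (a0 + a1 - 2 * a2 - a3 - a4) * y ^+ 2
          - 2 * (a0 + a1 - a3 - a4) * x * y
          + (a0 + a1 - 2 * a3 - (2 * a0 + 2 * a2 - a3 - a4) * eta) * x
          + (- a0 - a1 + 2 * a2 + 2 * a3 + (2 * a0 - a3 - a4) * eta) * y
          + (eta - 1) * (a2 + a3 + (a0 + a2) * eta)).

Definition D4_system (F : fieldType) (D : F -> F) (b eta : F) (a : 5.-tuple F)
    (u : 3.-tuple F) : Prop :=
  [/\ 2 * eta / b * D u`_0 = D4_P eta a u,
      - (2 * eta / b) * D u`_1 = D4_Q eta a u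
    & 2 * eta / b * D u`_2 = D4_R eta a u].

Definition D4_normalized (F : comNzRingType) (a : 5.-tuple F) : Prop :=
  a`_0 + a`_1 + 2 * a`_2 + a`_3 + a`_4 = 1.

(* The locus alpha_4 = alpha_1, alpha_0 = alpha_3 in the coordinates
   beta = (alpha_3, alpha_2, alpha_1). *)
Definition alpha_of_beta (F : nmodType) (beta : 3.-tuple F) : 5.-tuple F :=
  [tuple beta`_0; beta`_2; beta`_1; beta`_0; beta`_2].

Definition is_param (F : fieldType) (beta : 3.-tuple F) : Prop :=
  beta`_0 + beta`_1 + beta`_2 = 2^-1.

Lemma D4_normalized_beta (F : numFieldType) (beta : 3.-tuple F) :
  D4_normalized (alpha_of_beta beta) <-> is_param beta.
Proof.
have two0 : (2 : F) != 0 by rewrite pnatr_eq0.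
rewrite /D4_normalized /is_param /=.
have -> : beta`_0 + beta`_2 + 2 * beta`_1 + beta`_0 + beta`_2
          = 2 * (beta`_0 + beta`_1 + beta`_2) by ring.
split=> h; last by rewrite h divff.
by apply: (mulfI two0); rewrite h divff.
Qed.

Section RationalTransformations.

Variable R : realType.
Local Notation C := R[i].
Local Notation "x %:F" := (@FracField.tofrac _ x).

(* C(t), C(t)[x, y, z] and C(t)(x, y, z). *)
Definition Ct : fieldType := {fraction {poly C}}.
Definition Ctxyz_poly : idomainType := {mpoly Ct[3]}.
Definition Ctxyz : fieldType := {fraction Ctxyz_poly}.

Definition Ct_const (c : C) : Ct := (c%:P)%:F.
Definition of_Ct (k : Ct) : Ctxyz := (k%:MP : Ctxyz_poly)%:F.
Definition of_C (c : C) : Ctxyz := of_Ct (Ct_const c).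
Definition xyz : 3.-tuple Ctxyz := [tuple ('X_i : Ctxyz_poly)%:F | i < 3].

(* Quotient rule and substitution on a fraction field, computed on the chosen
   representative numerator / denominator. *)
Definition frac_deriv (A : idomainType) (d : A -> {fraction A})
    (f : {fraction A}) : {fraction A} :=
  let: n := \n_(repr f) in let: m := \d_(repr f) in
  (d n * m%:F - n%:F * d m) / m%:F ^+ 2.

Definition frac_eval (A : idomainType) (F : fieldType) (g : A -> F)
    (f : {fraction A}) : F :=
  g \n_(repr f) / g \d_(repr f).

(* d/dt on C(t). *)
Definition ddt : Ct -> Ct := frac_deriv (fun p : {poly C} => (p^`())%:F).

(* The derivation of C(t)(x, y, z) that extends d/dt and sends the
   coordinates x, y, z to the components of v. *)
Definition total_deriv (v : 3.-tuple Ctxyz) : Ctxyz -> Ctxyz :=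
  frac_deriv (fun p : Ctxyz_poly =>
    mmap (fun k => of_Ct (ddt k)) (tnth xyz) p
    + \sum_(i < 3) (mderiv i p : Ctxyz_poly)%:F * tnth v i).

(* f(v), for v a triple of rational functions. *)
Definition rsubst (v : 3.-tuple Ctxyz) : Ctxyz -> Ctxyz :=
  frac_eval (fun p : Ctxyz_poly => mmap of_Ct (tnth v) p).

(* The system restricted to alpha_4 = alpha_1, alpha_0 = alpha_3. *)
Definition beta_system (eta : C) (b : Ct) (beta : 3.-tuple C)
    (D : Ctxyz -> Ctxyz) (u : 3.-tuple Ctxyz) : Prop :=
  D4_system D (of_Ct b) (of_C eta) (map_tuple of_C (alpha_of_beta beta)) u.

(* d/dt along the restricted system with parameters beta: the derivation for
   which (x, y, z) itself is a solution. *)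
Definition flow (eta : C) (b : Ct) (beta : 3.-tuple C) : Ctxyz -> Ctxyz :=
  let: c := of_Ct b / (2 * of_C eta) in
  let: a := map_tuple of_C (alpha_of_beta beta) in
  total_deriv [tuple c * D4_P (of_C eta) a xyz;
                     - (c * D4_Q (of_C eta) a xyz);
                     c * D4_R (of_C eta) a xyz].

(* A transformation of variables and parameters
   (x, y, z; beta) -> (tvar beta; tpar beta), where tvar beta consists of
   rational functions of (x, y, z) over C(t). *)
Record transf := Transf {
  tvar : 3.-tuple C -> 3.-tuple Ctxyz;
  tpar : 3.-tuple C -> 3.-tuple C }.

Definition tid : transf := Transf (fun=> xyz) id.

(* T after S. *)
Definition tcomp (T S : transf) : transf :=
  Transf (fun beta => map_tuple (rsubst (tvar S beta)) (tvar T (tpar S beta)))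
         (fun beta => tpar T (tpar S beta)).

Definition tpow (T : transf) (n : nat) : transf := iter n (tcomp T) tid.

Definition teq (T S : transf) : Prop :=
  forall beta, is_param beta -> tvar T beta = tvar S beta
                             /\ tpar T beta = tpar S beta.

(* Rational dependence on (x, y, z, beta), resp. on beta, defined at every
   beta with beta_0 + beta_1 + beta_2 = 1/2. *)
Definition rational_in_xyz_beta (f : 3.-tuple C -> Ctxyz) : Prop :=
  exists p q : {mpoly Ct[3 + 3]}, forall beta, is_param beta ->
    let: w := cat_tuple xyz (map_tuple of_C beta) in
    mmap of_Ct (tnth w) q != 0
    /\ f beta = mmap of_Ct (tnth w) p / mmap of_Ct (tnth w) q.

Definition rational_in_beta (f : 3.-tuple C -> C) : Prop :=
  exists p q : {mpoly C[3]}, forall beta, is_param beta ->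
    q.@[tnth beta] != 0 /\ f beta = p.@[tnth beta] / q.@[tnth beta].

Definition rational_transf (T : transf) : Prop :=
  [/\ forall i, rational_in_xyz_beta (fun beta => tnth (tvar T beta) i),
      forall i, rational_in_beta (fun beta => tnth (tpar T beta) i)
    & forall beta, is_param beta -> is_param (tpar T beta)].

Definition birational_transf (T : transf) : Prop :=
  rational_transf T /\
  exists T', [/\ rational_transf T', teq (tcomp T T') tid
               & teq (tcomp T' T) tid].

Definition Backlund (eta : C) (b : Ct) (T : transf) : Prop :=
  birational_transf T /\
  forall beta, is_param beta ->
    beta_system eta b (tpar T beta) (flow eta b beta) (tvar T beta).

Definition affine_Weyl_D32_relations (s0 s1 s2 : transf) : Prop :=
  [/\ [/\ teq (tpow s0 2) tid, teq (tpow s1 2) tid & teq (tpow s2 2) tid],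
      teq (tpow (tcomp s0 s1) 4) tid,
      teq (tpow (tcomp s1 s2) 4) tid
    & teq (tpow (tcomp s0 s2) 2) tid].

Definition s0 (eta : C) : transf :=
  Transf
    (fun beta =>
       let: x := xyz`_0 in let: y := xyz`_1 in let: z := xyz`_2 in
       [tuple x; y;
          z - of_C beta`_0 * (x + y - of_C eta - 1)
              / ((x - of_C eta) * (y - 1))])
    (fun beta => [tuple - beta`_0; beta`_1 + 2 * beta`_0; beta`_2]).

Definition s1 : transf :=
  Transf
    (fun beta =>
       let: x := xyz`_0 in let: y := xyz`_1 in let: z := xyz`_2 in
       [tuple x + of_C beta`_1 / z; y + of_C beta`_1 / z; z])
    (fun beta => [tuple beta`_0 + beta`_1; - beta`_1; beta`_2 + beta`_1]).

Definition s2 : transf :=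
  Transf
    (fun beta =>
       let: x := xyz`_0 in let: y := xyz`_1 in let: z := xyz`_2 in
       [tuple x; y; z - of_C beta`_2 * (x + y) / (x * y)])
    (fun beta => [tuple beta`_0; beta`_1 + 2 * beta`_2; - beta`_2]).

End RationalTransformations.

(* Main.v *)
From HB Require Import structures.
Require Import Defs.
From mathcomp Require Import all_boot all_order all_algebra.
From mathcomp Require Import generic_quotient complex reals mpoly ring.
Set Implicit Arguments.
Unset Strict Implicit.
Unset Printing Implicit Defensive.
Import GRing.Theory Num.Theory.
Local Open Scope ring_scope.
Local Open Scope quotient_scope.

Local Notation "x %:F" := (@FracField.tofrac _ x).

(** The three reflections are compositions of two kinds of elementary moves of
    a triple (x, y, z): [pole_shift p q a] subtracts a / (x - p) + a / (y - q)
    from z, and [diag_shift b] adds b / z to both x and y.  With constants p, q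
    these are the moves of s_0 (p = eta, q = 1), of s_2 (p = q = 0) and of s_1.

    Symmetry.  In any field with a derivation and 2 invertible, a move carries
    a solution of the system to a solution of the system with the reflected
    parameters.  Once the derivative of the moved triple is computed by the
    Leibniz rule and the system is substituted in it, this is an identity of
    rational functions in x, y, z, eta and two of the beta_i, the third being
    eliminated through beta_0 + beta_1 + beta_2 = 1/2 ([D4_system_s0],
    [D4_system_s1], [D4_system_s2]).  It applies to the coordinates
    of C(t)(x, y, z), which form a solution for the derivation [flow].

    Relations.  Composition is defined by substituting fractions through a
    chosen numerator and denominator; this is a field morphism as soon as the
    triple v being substituted is [generic], that is, when no nonzero
    polynomial vanishes at v.  The moves preserve generic triples
    ([generic_pole_shift], [generic_diag_shift]): a move of the coordinates has
    an inverse move, and a polynomial relation between the moved coordinates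
    would be carried by this inverse to a relation between the coordinates
    ([generic_extends]).  A transformation thus acts by a genuine function
    [act] on pairs of a generic triple and a parameter, composition becomes
    composition of functions ([act_tcomp]), and a transformation is determined
    by its action on the coordinates ([teq_act]).  At generic triples no
    denominator vanishes, so that each relation is an identity between rational
    expressions, whatever the parameters.  Moves with opposite parameters are
    inverse to each other, two pole shifts commute, and the relations of order
    four come from the braid relation [shift_braid] between a pole shift and a
    diagonal shift. *)

(** * Words in two involutions *)

Section Words.
Variables (X : Type) (G : X -> Prop) (f g : X -> X).
Hypotheses (fG : forall s, G s -> G (f s)) (gG : forall s, G s -> G (g s)).
Hypothesis fK : forall s, G s -> f (f s) = s.
Hypothesis gK : forall s, G s -> g (g s) = s.

Lemma iter2_commute s : (forall s, G s -> f (g s) = g (f s)) -> G s ->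
  iter 2 (f \o g) s = s.
Proof. by move=> fg Gs; rewrite /= -fg; auto; rewrite fK ?gK; auto. Qed.

(** From (f g)^2 = (g f)^2 one gets (f g)^4 = (f g)^2 (g f)^2, which cancels
    from the middle. *)
Lemma iter4_braid s : (forall s, G s -> f (g (f (g s))) = g (f (g (f s)))) ->
  G s -> iter 4 (f \o g) s = s.
Proof.
move=> fg Gs; rewrite /= (fg s) // gK; last by auto 6.
by rewrite fK ?gK ?fK; auto 6.
Qed.
End Words.

(** * Derivations and evaluations on fraction fields *)

(** The maps [d] that [frac_deriv] extends go from a ring to its fraction field,
    hence the morphism [h] in the Leibniz rule; [h = id] is the usual notion. *)
Definition derivation_along (A F : pzRingType) (h d : A -> F) : Prop :=
  (forall p q, d (p + q) = d p + d q)
  /\ (forall p q, d (p * q) = d p * h q + h p * d q).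

Lemma derivation_along1 (A F : pzRingType) (h d : A -> F) :
  derivation_along h d -> h 1 = 1 -> d 1 = 0.
Proof.
move=> [_ dM] h1; have := dM 1 1; rewrite !mulr1 h1 mulr1 mul1r.
by move=> /(congr1 (+%R^~ (- d 1))); rewrite addrK subrr.
Qed.

(** The formula for the derivative of a fraction does not depend on the fraction
    chosen: deriving n' m = n m' gives the equation between the derivatives. *)
Lemma quotient_rule_indep (F : fieldType) (n m n' m' dn dm dn' dm' : F) :
  m != 0 -> m' != 0 -> n' * m = n * m' ->
  dn' * m + n' * dm = dn * m' + n * dm' ->
  (dn' * m' - n' * dm') / m' ^+ 2 = (dn * m - n * dm) / m ^+ 2.
Proof.
move=> m0 m0' e ed.
have -> : dn' = (dn * m' + n * dm' - n' * dm) / m by rewrite -ed addrK mulfK.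
have -> : n' = n * m' / m by rewrite -e mulfK.
by field; rewrite m0 m0'.
Qed.

Lemma quotient_ruleD (F : fieldType) (n m n' m' dn dm dn' dm' : F) :
  m != 0 -> m' != 0 ->
  ((dn * m' + n * dm' + (dn' * m + n' * dm)) * (m * m')
     - (n * m' + n' * m) * (dm * m' + m * dm')) / (m * m') ^+ 2
  = (dn * m - n * dm) / m ^+ 2 + (dn' * m' - n' * dm') / m' ^+ 2.
Proof. by move=> m0 m0'; field; rewrite m0 m0'. Qed.

Lemma quotient_ruleM (F : fieldType) (n m n' m' dn dm dn' dm' : F) :
  m != 0 -> m' != 0 ->
  ((dn * n' + n * dn') * (m * m') - n * n' * (dm * m' + m * dm'))
    / (m * m') ^+ 2
  = (dn * m - n * dm) / m ^+ 2 * (n' / m')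
    + n / m * ((dn' * m' - n' * dm') / m' ^+ 2).
Proof. by move=> m0 m0'; field; rewrite m0 m0'. Qed.

Section Fractions.
Variable A : idomainType.

Lemma frac_repr (f : {fraction A}) : f = (\n_(repr f))%:F / (\d_(repr f))%:F.
Proof.
have d0 : (\d_(repr f))%:F != 0 :> {fraction A}.
  by rewrite tofrac_eq0 denom_ratioP.
apply: (mulIf d0); rewrite mulfVK //.
rewrite -{1}[f]reprK; case: (repr f) => -[n d] /= d0'.
unlock FracField.tofrac; rewrite -[LHS]FracField.pi_mul.
apply/eqmodP; rewrite /= FracField.equivfE /FracField.mulf.
by rewrite !numden_Ratio ?mulf_neq0 ?oner_neq0 //= !mulr1 mulrC.
Qed.

Lemma fracP (f : {fraction A}) : exists n d, d != 0 /\ f = n%:F / d%:F.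
Proof.
exists \n_(repr f), \d_(repr f).
by split; [exact: denom_ratioP | exact: frac_repr].
Qed.

Lemma frac_eq (n d n' d' : A) : d != 0 -> d' != 0 ->
  n%:F / d%:F = n'%:F / d'%:F -> n * d' = n' * d.
Proof.
rewrite -!(tofrac_eq0 d) -(tofrac_eq0 d') => d0 d0' /eqP.
by rewrite eqr_div // -!tofracM tofrac_eq => /eqP.
Qed.

Section Derivation.
Variable d : A -> {fraction A}.
Hypothesis d_der : derivation_along (@FracField.tofrac A) d.

Lemma frac_derivE (n m : A) : m != 0 ->
  frac_deriv d (n%:F / m%:F) = (d n * m%:F - n%:F * d m) / m%:F ^+ 2.
Proof.
move=> m0; rewrite /frac_deriv; have := frac_repr (n%:F / m%:F).
have := denom_ratioP (repr (n%:F / m%:F)).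
move: (\n_(repr _)) (\d_(repr _)) => n' m' m0' /esym /(frac_eq m0' m0) e.
have := congr1 (@FracField.tofrac A) e; rewrite !tofracM => eF.
have := congr1 d e; rewrite !d_der.2 => ed.
have mF0 : m%:F != 0 by rewrite tofrac_eq0.
have mF0' : m'%:F != 0 by rewrite tofrac_eq0.
exact: quotient_rule_indep eF ed.
Qed.

Lemma frac_deriv_tofrac (a : A) : frac_deriv d a%:F = d a.
Proof.
rewrite -[a%:F]divr1 -tofrac1 frac_derivE ?oner_neq0 //.
rewrite (derivation_along1 d_der) // tofrac1.
by rewrite mulr0 subr0 mulr1 expr1n divr1.
Qed.

Lemma frac_deriv_derivation : derivation_along id (frac_deriv d).
Proof.
split=> f g; have [n [m [m0 ->]]] := fracP f;
  have [n' [m' [m0' ->]]] := fracP g.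
all: have mF0 : m%:F != 0 by rewrite tofrac_eq0.
all: have mF0' : m'%:F != 0 by rewrite tofrac_eq0.
- rewrite addf_div // -!tofracM -tofracD !frac_derivE ?mulf_neq0 //.
  rewrite d_der.1 !d_der.2 !tofracD !tofracM; exact: quotient_ruleD.
- rewrite mulf_div // -!tofracM !frac_derivE ?mulf_neq0 //.
  rewrite !d_der.2 !tofracM; exact: quotient_ruleM.
Qed.

End Derivation.

Section Eval.
Variables (F : fieldType) (g : {rmorphism A -> F}).

(** The evaluation [g] makes sense at the fraction [f], with value [w]: [g]
    extends to the localization of [A] at the elements that it does not kill.
    This covers evaluations that are not known to be injective. *)
Definition extends_at (f : {fraction A}) (w : F) : Prop :=
  exists n m, [/\ g m != 0, f = n%:F / m%:F & w = g n / g m].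

Lemma denom_neq0 m : g m != 0 -> m%:F != 0 :> {fraction A}.
Proof. by rewrite tofrac_eq0; apply: contraNneq => ->; rewrite rmorph0. Qed.

Lemma extends_at_unique f w w' : extends_at f w -> extends_at f w' -> w = w'.
Proof.
move=> [n [m [m0 -> ->]]] [n' [m' [m0' e ->]]].
have [mF mF'] := (denom_neq0 m0, denom_neq0 m0'); rewrite !tofrac_eq0 in mF mF'.
have := congr1 g (frac_eq mF mF' e); rewrite !rmorphM => E.
by apply/eqP; rewrite eqr_div // E.
Qed.

Lemma extends_at_tofrac a : extends_at a%:F (g a).
Proof. by exists a, 1; rewrite rmorph1 oner_neq0 tofrac1 !divr1. Qed.

Lemma extends_at0 : extends_at 0 0.
Proof. by have := extends_at_tofrac 0; rewrite tofrac0 rmorph0. Qed.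

Lemma extends_at1 : extends_at 1 1.
Proof. by have := extends_at_tofrac 1; rewrite tofrac1 rmorph1. Qed.

Lemma extends_atD f f' w w' :
  extends_at f w -> extends_at f' w' -> extends_at (f + f') (w + w').
Proof.
move=> [n [m [m0 -> ->]]] [n' [m' [m0' -> ->]]].
exists (n * m' + n' * m), (m * m').
by rewrite !addf_div ?denom_neq0 // !(rmorphD, rmorphM) /= mulf_neq0.
Qed.

Lemma extends_atN f w : extends_at f w -> extends_at (- f) (- w).
Proof.
by move=> [n [m [m0 -> ->]]]; exists (- n), m; rewrite !rmorphN !mulNr.
Qed.

Lemma extends_atM f f' w w' :
  extends_at f w -> extends_at f' w' -> extends_at (f * f') (w * w').
Proof.
move=> [n [m [m0 -> ->]]] [n' [m' [m0' -> ->]]].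
by exists (n * n'), (m * m'); rewrite !mulf_div !rmorphM mulf_neq0.
Qed.

Lemma extends_atV f w : w != 0 -> extends_at f w -> extends_at f^-1 w^-1.
Proof.
move=> w0 [n [m [m0 -> E]]]; exists m, n; rewrite E !invf_div; split=> //.
by apply: contraNneq w0 => n0; rewrite E n0 mul0r.
Qed.

Hypothesis g_inj : injective g.

(** Carries the proof of injectivity so that the evaluation can be declared a
    field morphism. *)
Definition frac_morph of injective g := frac_eval g.
Local Notation phi := (frac_morph g_inj).

(** For an injective [g], the chosen representatives can be replaced by any
    others. *)
Lemma frac_morphE (n m : A) : m != 0 -> phi (n%:F / m%:F) = g n / g m.
Proof.
move=> m0; have g0 p : p != 0 -> g p != 0 by rewrite raddf_eq0.
apply: (@extends_at_unique (n%:F / m%:F)); last by exists n, m; rewrite g0.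
exists \n_(repr (n%:F / m%:F)), \d_(repr (n%:F / m%:F)).
by rewrite -frac_repr; split=> //; exact/g0/denom_ratioP.
Qed.

Lemma frac_morph_is_zmod_morphism : zmod_morphism phi.
Proof.
move=> f f'; have [n [m [m0 ->]]] := fracP f.
have [n' [m' [m0' ->]]] := fracP f'.
have g0 p : p != 0 -> g p != 0 by rewrite raddf_eq0.
rewrite -mulNr addf_div ?tofrac_eq0 // -tofracN -!tofracM -tofracD.
rewrite !frac_morphE ?mulf_neq0 // -mulNr addf_div ?g0 //.
by rewrite !(rmorphD, rmorphM, rmorphN).
Qed.

Lemma frac_morph_is_monoid_morphism : monoid_morphism phi.
Proof.
split=> [|f f'].
  rewrite -[X in phi X]divr1 -tofrac1 frac_morphE ?oner_neq0 //.
  by rewrite rmorph1 divr1.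
have [n [m [m0 ->]]] := fracP f; have [n' [m' [m0' ->]]] := fracP f'.
have g0 p : p != 0 -> g p != 0 by rewrite raddf_eq0.
rewrite mulf_div -!tofracM !frac_morphE ?mulf_neq0 // !rmorphM.
by rewrite mulf_div.
Qed.

HB.instance Definition _ :=
  GRing.isZmodMorphism.Build _ _ phi frac_morph_is_zmod_morphism.
HB.instance Definition _ :=
  GRing.isMonoidMorphism.Build _ _ phi frac_morph_is_monoid_morphism.

Lemma frac_morph_tofrac a : phi a%:F = g a.
Proof.
by rewrite -[a%:F]divr1 -tofrac1 frac_morphE ?oner_neq0 // rmorph1 divr1.
Qed.
End Eval.
End Fractions.

Section MorphFrac.
Variables (S : comNzRingType) (F : fieldType) (g : {rmorphism S -> F}).

Lemma rmorph_fracD n d n' d' : g d != 0 -> g d' != 0 ->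
  g (d * d') != 0 /\ g n / g d + g n' / g d' = g (n * d' + n' * d) / g (d * d').
Proof.
by move=> d0 d0'; rewrite addf_div // !(rmorphD, rmorphM) /= mulf_neq0.
Qed.

Lemma rmorph_fracM n d n' d' : g d != 0 -> g d' != 0 ->
  g (d * d') != 0 /\ g n / g d * (g n' / g d') = g (n * n') / g (d * d').
Proof. by move=> d0 d0'; rewrite mulf_div !rmorphM mulf_neq0. Qed.

Lemma rmorph_fracV n d : g n / g d != 0 ->
  g n != 0 /\ (g n / g d)^-1 = g d / g n.
Proof. by rewrite mulf_eq0 negb_or invf_div => /andP[]. Qed.
End MorphFrac.

(** * Polynomials in several variables *)

Lemma mpolyXU_neqC n (S : comNzRingType) (i : 'I_n) (c : S) :
  'X_i - c%:MP != 0 :> {mpoly S[n]}.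
Proof.
apply/eqP => /(congr1 (mcoeff U_(i))) /eqP.
by rewrite mcoeffB mcoeffX mcoeffC mcoeff0 eqxx mnm1_eq0 mulr0 subr0 oner_eq0.
Qed.

Section Mpoly.
Variables (n : nat) (S F : comNzRingType).

(** A ring morphism on polynomials is determined by its values on constants and
    variables. *)
Lemma rmorph_mpolyE (g : {rmorphism {mpoly S[n]} -> F}) p :
  g p = mmap (fun c => g c%:MP) (fun i => g 'X_i) p.
Proof.
rewrite {1}[p]mpolyE rmorph_sum /mmap; apply: eq_bigr => m _.
rewrite -mul_mpolyC rmorphM /mmap1 mpolyXE_id rmorph_prod; congr (_ * _).
by apply: eq_bigr => i _; rewrite rmorphXn.
Qed.

Variables (f : {rmorphism S -> F}) (h : 'I_n -> F) (d : {additive S -> F}).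

Lemma mmapMX c m : mmap d h (c%:MP * 'X_[m]) = d c * mmap1 h m.
Proof.
rewrite mul_mpolyC; have [->|c0] := eqVneq c 0.
  by rewrite scale0r !raddf0 mul0r.
by rewrite /mmap msuppMCX // big_seq1 mcoeffZ mcoeffX eqxx mulr1.
Qed.

(** By additivity it is enough to look at products of two monomials. *)
Lemma mmap_derivation : derivation_along f d ->
  derivation_along (mmap f h) (mmap d h).
Proof.
move=> [_ dM]; split=> [p q|p q]; first exact: raddfD.
rewrite [p]mpolyE [q]mpolyE.
elim/big_rec: _ => [|m p' _ IH]; first by rewrite !raddf0 !mul0r raddf0 addr0.
rewrite mulrDl !raddfD /= {}IH !mulrDl.
rewrite [RHS]addrACA; congr (_ + _).
elim/big_rec: _ => [|m' q' _ IH]; first by rewrite !raddf0 !mulr0 raddf0 addr0.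
rewrite mulrDr !raddfD /= {}IH !mulrDr.
rewrite [RHS]addrACA; congr (_ + _).
rewrite -!mul_mpolyC mulrACA -mpolyCM -mpolyXD !mmapMX !rmorphM /=.
rewrite !mmapC !mmapX.
rewrite dM commr_mmap1_M; last by move=> *; exact: mulrC.
by rewrite mulrDl mulrACA (mulrACA (f _)).
Qed.

Lemma eq_mmap (f1 f2 : S -> F) (h1 h2 : 'I_n -> F) p :
  f1 =1 f2 -> h1 =1 h2 -> mmap f1 h1 p = mmap f2 h2 p.
Proof.
move=> ef eh; rewrite /mmap; apply: eq_bigr => m _.
by rewrite ef; congr (_ * _); apply: mmap1_eq.
Qed.
End Mpoly.

(** * Elementary moves and their braid relation *)

Lemma tuple3P (T : Type) (u : 3.-tuple T) : exists x y z, u = [tuple x; y; z].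
Proof.
by case: u => -[|x [|y [|z [|? ?]]]] // i; exists x, y, z; apply: val_inj.
Qed.

Section Moves.
Variable F : fieldType.
Implicit Types (u : 3.-tuple F).

Definition pole_shift (p q a : F) u : 3.-tuple F :=
  [tuple u`_0; u`_1;
     u`_2 - a * (u`_0 + u`_1 - p - q) / ((u`_0 - p) * (u`_1 - q))].

Definition diag_shift (b : F) u : 3.-tuple F :=
  [tuple u`_0 + b / u`_2; u`_1 + b / u`_2; u`_2].

Definition off_poles (p q : F) u : Prop :=
  [/\ u`_0 - p != 0, u`_1 - q != 0 & u`_2 != 0].

Lemma pole_shift0 p q a u : (pole_shift p q a u)`_0 = u`_0. Proof. by []. Qed.
Lemma pole_shift1 p q a u : (pole_shift p q a u)`_1 = u`_1. Proof. by []. Qed.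
Lemma diag_shift2 b u : (diag_shift b u)`_2 = u`_2. Proof. by []. Qed.

Lemma off_polesE p q v w z : off_poles p q [tuple v + p; w + q; z] ->
  [/\ v != 0, w != 0 & z != 0].
Proof. by rewrite /off_poles /= !addrK. Qed.

Lemma pole_shiftK p q a u : pole_shift p q (- a) (pole_shift p q a u) = u.
Proof.
have [x [y [z ->]]] := tuple3P u.
apply/val_inj; congr [:: _; _; _]; rewrite /=; ring.
Qed.

Lemma diag_shiftK b u : diag_shift (- b) (diag_shift b u) = u.
Proof.
have [x [y [z ->]]] := tuple3P u.
apply/val_inj; congr [:: _; _; _]; rewrite /=; ring.
Qed.

Lemma pole_shiftC p q p' q' a a' u :
  pole_shift p q a (pole_shift p' q' a' u)
  = pole_shift p' q' a' (pole_shift p q a u).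
Proof. by apply/val_inj; congr [:: _; _; _]; rewrite /=; ring. Qed.

(** Both sides have the closed form
      x = p + (v z + b) A / N,  y = q + (w z + b) B / N,  z = M N / (A B)
    where v = x - p, w = y - q and A, B, M, N are the polynomials introduced
    along the proof, namely the numerators that appear at the intermediate
    triples.  The assumptions at these triples say that they do not vanish. *)
Lemma shift_braid p q a b u :
  let Sh := pole_shift p q in let Tr := diag_shift in
  off_poles p q u -> off_poles p q (Tr b u) ->
  off_poles p q (Sh (a + b) (Tr b u)) ->
  off_poles p q (Sh a u) -> off_poles p q (Tr (b + 2 * a) (Sh a u)) ->
  Sh a (Tr (b + 2 * a) (Sh (a + b) (Tr b u)))
  = Tr b (Sh (a + b) (Tr (b + 2 * a) (Sh a u))).
Proof.
move=> Sh Tr; have [x [y [z ->]]] := tuple3P u.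
have [v ->] : exists v, x = v + p by exists (x - p); ring.
have [w ->] : exists w, y = w + q by exists (y - q); ring.
move/off_polesE => [v0 w0 z0].
have -> : Tr b [tuple v + p; w + q; z]
    = [tuple (v * z + b) / z + p; (w * z + b) / z + q; z].
  by apply/val_inj; congr [:: _; _; _]; rewrite /=; field.
move/off_polesE; rewrite !mulf_eq0 !negb_or => -[/andP[vz0 _] /andP[wz0 _] _].
pose N := v * w * z ^+ 2 - a * (v + w) * z - b * (b + 2 * a).
have -> : Sh (a + b) [tuple (v * z + b) / z + p; (w * z + b) / z + q; z]
    = [tuple (v * z + b) / z + p; (w * z + b) / z + q;
         z * N / ((v * z + b) * (w * z + b))].
  apply/val_inj; congr [:: _; _; _]; rewrite /N /=; field.
  by rewrite ?addrK z0 vz0 wz0.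
move/off_polesE => [_ _]; rewrite !mulf_eq0 !negb_or => /andP[/andP[_ N0] _].
pose M := v * w * z - a * (v + w).
have -> : Sh a [tuple v + p; w + q; z] = [tuple v + p; w + q; M / (v * w)].
  apply/val_inj; congr [:: _; _; _]; rewrite /M /=; field.
  by rewrite ?addrK v0 w0.
move/off_polesE => [_ _]; rewrite !mulf_eq0 !negb_or => /andP[M0 _].
pose A := v * w * z - a * v + (a + b) * w.
pose B := v * w * z - a * w + (a + b) * v.
have -> : Tr (b + 2 * a) [tuple v + p; w + q; M / (v * w)]
    = [tuple v * A / M + p; w * B / M + q; M / (v * w)].
  apply/val_inj; congr [:: _; _; _]; move: M0; rewrite /A /B /M /= => M0; field.
    by rewrite M0 v0 w0.
  by rewrite M0 v0 w0.
move/off_polesE; rewrite !mulf_eq0 !negb_or => -[].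
move=> /andP[/andP[_ A0] _] /andP[/andP[_ B0] _] _.
have -> : Sh (a + b) [tuple v * A / M + p; w * B / M + q; M / (v * w)]
    = [tuple v * A / M + p; w * B / M + q; M * N / (A * B)].
  apply/val_inj; congr [:: _; _; _]; rewrite /= ?addrK.
  move: M0 A0 B0; rewrite /A /B /M /N => M0 A0 B0; field.
  by rewrite M0 A0 B0 v0 w0.
have -> : Tr (b + 2 * a) [tuple (v * z + b) / z + p; (w * z + b) / z + q;
         z * N / ((v * z + b) * (w * z + b))]
    = [tuple (v * z + b) * A / N + p; (w * z + b) * B / N + q;
         z * N / ((v * z + b) * (w * z + b))].
  apply/val_inj; congr [:: _; _; _]; move: N0; rewrite /A /B /N /= => N0; field.
    by rewrite N0 z0 vz0 wz0.
  by rewrite N0 z0 vz0 wz0.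
apply/val_inj; congr [:: _; _; _]; rewrite /= ?addrK;
  move: M0 A0 B0 N0; rewrite /A /B /M /N => M0 A0 B0 N0; field;
  by rewrite ?M0 ?A0 ?B0 ?N0 ?v0 ?w0 ?vz0 ?wz0 ?z0.
Qed.
End Moves.

Lemma map_pole_shift (F F' : fieldType) (g : {rmorphism F -> F'}) p q a u :
  map_tuple g (pole_shift p q a u)
  = pole_shift (g p) (g q) (g a) (map_tuple g u).
Proof.
have [x [y [z ->]]] := tuple3P u; apply/val_inj; congr [:: _; _; _] => /=.
by rewrite rmorphB fmorph_div !(rmorphM, rmorphB, rmorphD).
Qed.

Lemma map_diag_shift (F F' : fieldType) (g : {rmorphism F -> F'}) b u :
  map_tuple g (diag_shift b u) = diag_shift (g b) (map_tuple g u).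
Proof.
have [x [y [z ->]]] := tuple3P u; apply/val_inj.
by congr [:: _; _; _]; rewrite /= rmorphD fmorph_div.
Qed.

Section ExtendsShift.
Variables (A : idomainType) (F : fieldType) (g : {rmorphism A -> F}).
Local Notation ext := (extends_at g).
Variables (u : 3.-tuple {fraction A}) (u' : 3.-tuple F).
Hypothesis uu' : forall k, (k < 3)%N -> ext u`_k u'`_k.

(** The moves are rational expressions, so they commute with the evaluation as
    long as their denominators do not evaluate to zero. *)
Lemma extends_at_pole_shift p q a p' q' a' k :
  ext p p' -> ext q q' -> ext a a' -> u'`_0 - p' != 0 -> u'`_1 - q' != 0 ->
  (k < 3)%N -> ext (pole_shift p q a u)`_k (pole_shift p' q' a' u')`_k.
Proof.
move=> pp qq aa x0 y0; case: k => [|[|[|//]]] _ /=; try exact: uu'.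
apply: extends_atD; first exact: uu'.
apply/extends_atN/extends_atM; last apply: extends_atV.
- apply: extends_atM => //; do 2!(apply: extends_atD; last exact: extends_atN).
  by apply: extends_atD; apply: uu'.
- exact: mulf_neq0.
- by apply: extends_atM; (apply: extends_atD; last exact: extends_atN);
    apply: uu'.
Qed.

Lemma extends_at_diag_shift b b' k : ext b b' -> u'`_2 != 0 -> (k < 3)%N ->
  ext (diag_shift b u)`_k (diag_shift b' u')`_k.
Proof.
move=> bb z0; case: k => [|[|[|//]]] _ /=; try exact: uu'.
all: apply: extends_atD; first exact: uu'.
all: by apply: extends_atM => //; apply: extends_atV => //; apply: uu'.
Qed.
End ExtendsShift.

(** * Symmetries of the system over differential fields *)

Section DifferentialField.
Variables (F : fieldType) (D : F -> F).
Hypothesis D_der : derivation_along id D.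

Lemma der_sub x y : D (x - y) = D x - D y.
Proof.
have H : D (x - y) + D y = D x by rewrite -D_der.1 subrK.
by rewrite -H addrK.
Qed.

Lemma der_div x y : y != 0 -> D (x / y) = (D x * y - x * D y) / y ^+ 2.
Proof.
move=> y0; have := D_der.2 (x / y) y; rewrite mulfVK //= => ->.
by field.
Qed.

Lemma der_scale c a : D c = 0 -> D (c * a) = c * D a.
Proof. by move=> c0; rewrite D_der.2 c0 mul0r add0r. Qed.

Variables (b eta : F) (beta : 3.-tuple F).
Hypothesis two0 : (2 : F) != 0.
Hypothesis param : beta`_0 + beta`_1 + beta`_2 = 2^-1.
Hypotheses (D_eta : D eta = 0) (D_beta : forall i, D (tnth beta i) = 0).
Local Notation sys be u := (D4_system D b eta (alpha_of_beta be) u).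
Variable u : 3.-tuple F.

(** Here D (b_1 / z) = - b_1 / z^2 D z is added to D x and to D y. *)
Lemma D4_system_s1 : u`_2 != 0 -> sys beta u ->
  sys [tuple beta`_0 + beta`_1; - beta`_1; beta`_2 + beta`_1]
    (diag_shift beta`_1 u).
Proof.
move: D_beta param; have [x [y [z ->]]] := tuple3P u.
have [b0 [b1 [b2 ->]]] := tuple3P beta; rewrite /= => Db h z0 [].
have D1 : D b1 = 0 by have := Db (inord 1); rewrite (tnth_nth 0) inordK.
have b1E : b1 = 2^-1 - b0 - b2 by rewrite -h; ring.
rewrite /D4_system /=; set k := 2 * eta / b => hx hy hz.
have Dr : k * D (b1 / z) = - (b1 / z ^+ 2 * (k * D z)).
  by rewrite der_div // D1; field.
rewrite !D_der.1; rewrite !mulrDr hz; split.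
- rewrite hx Dr hz /D4_P /D4_R /= b1E; field; exact/andP.
- rewrite !mulNr Dr -mulNr hy hz /D4_Q /D4_R /= b1E; field; exact/andP.
- rewrite /D4_R /= b1E; field; exact/andP.
Qed.

(** The change of z has derivative b_2 (D x / x^2 + D y / y^2), and the factor
    of D y in the system has the opposite sign of that of D x. *)
Lemma D4_system_s2 : u`_0 != 0 -> u`_1 != 0 -> sys beta u ->
  sys [tuple beta`_0; beta`_1 + 2 * beta`_2; - beta`_2]
    (pole_shift 0 0 beta`_2 u).
Proof.
move: D_beta param; have [x [y [z ->]]] := tuple3P u.
have [b0 [b1 [b2 ->]]] := tuple3P beta; rewrite /= => Db h x0 y0 [].
have D2 : D b2 = 0 by have := Db (inord 2); rewrite (tnth_nth 0) inordK.
have b1E : b1 = 2^-1 - b0 - b2 by rewrite -h; ring.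
rewrite /D4_system /=; set k := 2 * eta / b => hx hy hz.
rewrite !subr0.
have Dr : k * D (b2 * (x + y) / (x * y))
  = - (b2 * ((k * D x) / x ^+ 2 - (- k * D y) / y ^+ 2)).
  rewrite der_div ?mulf_neq0 // (der_scale _ D2) D_der.1 D_der.2.
  by field; apply/andP.
rewrite der_sub mulrBr Dr hx hy hz; split.
- rewrite /D4_P /= b1E; field; exact/and3P.
- rewrite /D4_Q /= b1E; field; exact/and3P.
- rewrite /D4_R /D4_P /D4_Q /= b1E; field; exact/and3P.
Qed.

(** The same computation as for [D4_system_s2], with poles at x = eta, y = 1. *)
Lemma D4_system_s0 : u`_0 - eta != 0 -> u`_1 - 1 != 0 -> sys beta u ->
  sys [tuple - beta`_0; beta`_1 + 2 * beta`_0; beta`_2]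
    (pole_shift eta 1 beta`_0 u).
Proof.
move: D_beta param; have [x [y [z ->]]] := tuple3P u.
have [b0 [b1 [b2 ->]]] := tuple3P beta; rewrite /= => Db h x0 y0 [].
have D0 : D b0 = 0 by have := Db (inord 0); rewrite (tnth_nth 0) inordK.
have b1E : b1 = 2^-1 - b0 - b2 by rewrite -h; ring.
rewrite /D4_system /=; set k := 2 * eta / b => hx hy hz.
have D1 : D 1 = 0 := derivation_along1 D_der erefl.
have Dr : k * D (b0 * (x + y - eta - 1) / ((x - eta) * (y - 1)))
  = - (b0 * ((k * D x) / (x - eta) ^+ 2 - (- k * D y) / (y - 1) ^+ 2)).
  rewrite der_div ?mulf_neq0 // (der_scale _ D0) !der_sub D_der.1 D_der.2.
  rewrite !der_sub D_eta D1.
  by field; apply/andP.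
rewrite der_sub mulrBr Dr hx hy hz; split.
- rewrite /D4_P /= b1E; field; exact/and3P.
- rewrite /D4_Q /= b1E; field; exact/and3P.
- rewrite /D4_R /D4_P /D4_Q /= b1E; field; exact/and3P.
Qed.
End DifferentialField.

(** * Total derivatives and generic substitutions *)

Section RationalFunctions.
Variable R : realType.
Local Notation C := R[i].
Local Notation Ct := (Ct R).
Local Notation K := (Ctxyz R).
Local Notation A := (Ctxyz_poly R).
Local Notation of_Ct := (@of_Ct R).
Local Notation of_C := (@of_C R).
Local Notation xyz := (xyz R).
Implicit Types (u v w : 3.-tuple K) (beta : 3.-tuple C).

Lemma of_Ct_is_zmod_morphism : zmod_morphism of_Ct.
Proof. by move=> a b; rewrite /of_Ct mpolyCB tofracB. Qed.
Lemma of_Ct_is_monoid_morphism : monoid_morphism of_Ct.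
Proof.
by split=> [|a b]; rewrite /of_Ct ?mpolyC1 ?tofrac1 // mpolyCM tofracM.
Qed.
HB.instance Definition _ :=
  GRing.isZmodMorphism.Build _ _ of_Ct of_Ct_is_zmod_morphism.
HB.instance Definition _ :=
  GRing.isMonoidMorphism.Build _ _ of_Ct of_Ct_is_monoid_morphism.

Lemma Ct_const_is_zmod_morphism : zmod_morphism (@Ct_const R).
Proof. by move=> a b; rewrite /Ct_const polyCB tofracB. Qed.
Lemma Ct_const_is_monoid_morphism : monoid_morphism (@Ct_const R).
Proof.
by split=> [|a b]; rewrite /Ct_const ?polyC1 ?tofrac1 // polyCM tofracM.
Qed.
HB.instance Definition _ :=
  GRing.isZmodMorphism.Build _ _ (@Ct_const R) Ct_const_is_zmod_morphism.
HB.instance Definition _ :=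
  GRing.isMonoidMorphism.Build _ _ (@Ct_const R) Ct_const_is_monoid_morphism.
HB.instance Definition _ := GRing.RMorphism.copy of_C (of_Ct \o @Ct_const R).

(** The embedding of polynomials in their fractions is the evaluation at the
    coordinates, which makes the coordinates a triple like any other. *)
Lemma tofrac_mmap (p : A) : p%:F = mmap of_Ct (tnth xyz) p.
Proof.
rewrite (rmorph_mpolyE (@FracField.tofrac A)); apply: eq_mmap => // i.
by rewrite tnth_mktuple.
Qed.

Lemma derivation_ddt : derivation_along id (@ddt R).
Proof.
apply: frac_deriv_derivation; split=> p q; first by rewrite derivD tofracD.
by rewrite derivM tofracD !tofracM.
Qed.

Lemma ddt_is_zmod_morphism : zmod_morphism (@ddt R).
Proof. exact: der_sub derivation_ddt. Qed.
HB.instance Definition _ :=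
  GRing.isZmodMorphism.Build _ _ (@ddt R) ddt_is_zmod_morphism.

Lemma ddt_const c : ddt (Ct_const c) = 0 :> Ct.
Proof.
rewrite /ddt frac_deriv_tofrac ?derivC ?tofrac0 //.
by split=> p q; rewrite ?derivD ?derivM tofracD ?tofracM.
Qed.

Section TotalDerivative.
Variable v : 3.-tuple K.

(** Differentiating the coefficients and differentiating along [v] are both
    derivations. *)
Lemma total_deriv_poly : derivation_along (@FracField.tofrac A) (fun p : A =>
  mmap (of_Ct \o @ddt R) (tnth xyz) p
  + \sum_(i < 3) (mderiv i p : A)%:F * tnth v i).
Proof.
have [dD dM] : derivation_along (mmap of_Ct (tnth xyz))
    (mmap (of_Ct \o @ddt R) (tnth xyz)).
  apply: mmap_derivation; split=> a b /=; first by rewrite !raddfD.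
  by rewrite derivation_ddt.2 rmorphD !rmorphM.
split=> p q.
  rewrite dD addrACA -big_split; congr (_ + _); apply: eq_bigr => i _.
  by rewrite mderivD tofracD mulrDl.
rewrite dM -!tofrac_mmap mulrDl mulrDr addrACA; congr (_ + _).
rewrite mulr_suml mulr_sumr -big_split; apply: eq_bigr => i _ /=.
by rewrite mderivM tofracD !tofracM mulrDl mulrA mulrAC.
Qed.

Lemma total_deriv_derivation : derivation_along id (total_deriv v).
Proof. exact: frac_deriv_derivation total_deriv_poly. Qed.

Lemma total_deriv_tofrac (p : A) : total_deriv v p%:F =
  mmap (of_Ct \o @ddt R) (tnth xyz) p
  + \sum_(i < 3) (mderiv i p : A)%:F * tnth v i.
Proof. exact: frac_deriv_tofrac total_deriv_poly p. Qed.

Lemma total_deriv_const c : total_deriv v (of_C c) = 0.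
Proof.
rewrite /of_C /of_Ct total_deriv_tofrac mmapC /= ddt_const rmorph0 add0r.
by apply: big1 => i _; rewrite mderivC tofrac0 mul0r.
Qed.

Lemma total_deriv_coord i : total_deriv v (tnth xyz i) = tnth v i.
Proof.
rewrite tnth_mktuple total_deriv_tofrac.
have -> : mmap (of_Ct \o @ddt R) (tnth xyz) 'X_i = 0.
  rewrite -['X_i]mul1r -mpolyC1 mmapMX /=.
  by rewrite (derivation_along1 derivation_ddt) // rmorph0 mul0r.
rewrite add0r (bigD1 i) //= big1 ?addr0 => [|j ji].
  rewrite mderivX mnm1E eqxx scale1r (_ : (U_(i) - U_(i) = 0)%MM); last first.
    by apply/mnmP => j; rewrite mnmBE mnm0E subnn.
  by rewrite mpolyX0 tofrac1 mul1r.
by rewrite mderivX mnm1E eq_sym (negbTE ji) scale0r tofrac0 mul0r.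
Qed.
End TotalDerivative.

Definition subst_poly v : {rmorphism A -> K} := mmap of_Ct (tnth v).

(** Algebraic independence of the triple over C(t).  A variant, so that proof
    search does not unfold it into statements on fractions. *)
Variant generic v : Prop := Generic of injective (subst_poly v).

Lemma generic_inj v : generic v -> injective (subst_poly v).
Proof. by case. Qed.

Definition subst_morph v (gv : generic v) : {rmorphism K -> K} :=
  frac_morph (generic_inj gv).

Lemma rsubstE v (gv : generic v) f : rsubst v f = subst_morph gv f.
Proof. by []. Qed.

Lemma rsubst_tofrac v (p : A) : generic v -> rsubst v p%:F = subst_poly v p.
Proof. by move=> gv; rewrite (rsubstE gv) /= frac_morph_tofrac. Qed.

Lemma rsubst_frac v n d : generic v -> d != 0 ->
  rsubst v (n%:F / d%:F) = subst_poly v n / subst_poly v d.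
Proof. by move=> gv; exact: (frac_morphE (generic_inj gv)). Qed.

Lemma rsubst_div v f g : generic v ->
  rsubst v (f / g) = rsubst v f / rsubst v g.
Proof. by move=> gv; rewrite !(rsubstE gv) fmorph_div. Qed.

Lemma rsubst_Ct v k : generic v -> rsubst v (of_Ct k) = of_Ct k.
Proof. by move=> gv; rewrite rsubst_tofrac // /= mmapC. Qed.

Lemma rsubst_C v c : generic v -> rsubst v (of_C c) = of_C c.
Proof. exact: rsubst_Ct. Qed.

Lemma rsubst_coord v i : generic v -> rsubst v (tnth xyz i) = tnth v i.
Proof.
by move=> gv; rewrite tnth_mktuple rsubst_tofrac //= mmapX mmap1U.
Qed.

(** Both sides are ring morphisms in [p] with the same values on constants and
    variables. *)
Lemma subst_poly_comp v w : generic w ->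
  forall p, rsubst w (subst_poly v p) = subst_poly (map_tuple (rsubst w) v) p.
Proof.
move=> gw p; rewrite (rsubstE gw).
rewrite -[LHS]/((subst_morph gw \o subst_poly v) p) rmorph_mpolyE.
apply: eq_mmap => [c|i].
  by rewrite -[LHS]/(rsubst w (mmap of_Ct (tnth v) c%:MP)) mmapC rsubst_Ct.
by rewrite -[LHS]/(rsubst w (mmap of_Ct (tnth v) 'X_i)) mmapX mmap1U tnth_map.
Qed.

(** The evaluation at the substituted triple is the evaluation at [v] followed
    by a field morphism, which is injective. *)
Lemma generic_comp v w :
  generic v -> generic w -> generic (map_tuple (rsubst w) v).
Proof.
move=> gv gw; split=> p q; rewrite -!subst_poly_comp // !(rsubstE gw).
by move/fmorph_inj/(generic_inj gv).
Qed.

Lemma rsubst_comp v w f : generic v -> generic w ->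
  rsubst w (rsubst v f) = rsubst (map_tuple (rsubst w) v) f.
Proof.
move=> gv gw; have [n [d [d0 ->]]] := fracP f.
have gvw := generic_comp gv gw.
by rewrite !rsubst_frac // rsubst_div // !subst_poly_comp.
Qed.

Lemma generic_xyz : generic xyz.
Proof.
by split=> p q /=; rewrite -!tofrac_mmap => /eqP; rewrite tofrac_eq => /eqP.
Qed.

Lemma rsubst_id f : rsubst xyz f = f.
Proof.
have [n [d [d0 ->]]] := fracP f; rewrite (rsubst_frac _ generic_xyz d0).
by rewrite /= -!tofrac_mmap.
Qed.

(** If the evaluation at [v] takes the value x_i at w_i, then it takes the value
    p(x, y, z) at p(w); since p(w) = 0 is sent to 0, this forces p = 0. *)
Lemma generic_extends v w :
  (forall i, extends_at (subst_poly v) (tnth w i) (tnth xyz i)) -> generic w.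
Proof.
move=> vw; suff ext p : extends_at (subst_poly v) (subst_poly w p) p%:F.
  split; apply: raddf_inj => p p0; have := ext p.
  rewrite p0 => /extends_at_unique.
  by move/(_ _ (extends_at0 _))/eqP; rewrite tofrac_eq0 => /eqP.
have ext1 := extends_at1 (subst_poly v).
rewrite tofrac_mmap /= /mmap; apply: (big_ind2 (extends_at (subst_poly v))).
- exact: extends_at0.
- by move=> f w1 f' w1'; apply: extends_atD.
move=> m _; apply: extends_atM.
  by have := extends_at_tofrac (subst_poly v) (p@_m)%:MP; rewrite /= mmapC.
apply: (big_ind2 (extends_at (subst_poly v))) => [|f w1 f' w1'|i _].
- exact: ext1.
- exact: extends_atM.
by elim: (m i) => [|k IH]; rewrite ?expr0 // !exprS; apply: extends_atM.
Qed.

(** * Moves of generic triples *)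

Implicit Types (p q a b c : C).

(** The polynomial X_i - c is nonzero, so it does not vanish at [v]. *)
Lemma generic_avoids v i c : generic v -> tnth v i - of_C c != 0.
Proof.
move=> gv; have -> : tnth v i - of_C c = subst_poly v ('X_i - (Ct_const c)%:MP).
  by rewrite rmorphB /= mmapX mmap1U mmapC.
by rewrite (raddf_eq0 _ (generic_inj gv)) mpolyXU_neqC.
Qed.

Lemma generic_off_poles p q v : generic v -> off_poles (of_C p) (of_C q) v.
Proof.
move=> gv; have H k (k3 : (k < 3)%N) c : v`_k - of_C c != 0.
  by rewrite -(tnth_nth 0 v (Ordinal k3)) generic_avoids.
split; [exact: H|exact: H|].
by have := H 2%N isT 0; rewrite (rmorph0 of_C) subr0.
Qed.

Lemma extends_at_C v c : extends_at (subst_poly v) (of_C c) (of_C c).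
Proof.
by have := extends_at_tofrac (subst_poly v) (Ct_const c)%:MP; rewrite /= mmapC.
Qed.

Lemma extends_at_coord v k : (k < 3)%N -> extends_at (subst_poly v) xyz`_k v`_k.
Proof.
move=> k3; rewrite -!(tnth_nth 0 _ (Ordinal k3)) tnth_mktuple.
have := extends_at_tofrac (subst_poly v) 'X_(Ordinal k3).
by rewrite /= mmapX mmap1U.
Qed.

(** The evaluation at the inverse move sends the moved coordinates back to the
    coordinates. *)
Lemma generic_pole_shift_xyz p q a :
  generic (pole_shift (of_C p) (of_C q) (of_C a) xyz).
Proof.
pose v := pole_shift (of_C p) (of_C q) (- of_C a) xyz.
have E : pole_shift (of_C p) (of_C q) (of_C a) v = xyz.
  by rewrite /v -[X in pole_shift _ _ X]opprK pole_shiftK.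
have [x0 y0 _] := generic_off_poles p q generic_xyz.
apply: (@generic_extends v) => i; rewrite -{2}E !(tnth_nth 0).
apply: extends_at_pole_shift; try exact: extends_at_C.
- exact: extends_at_coord.
- by rewrite pole_shift0.
- by rewrite pole_shift1.
- exact: ltn_ord.
Qed.

Lemma generic_diag_shift_xyz b : generic (diag_shift (of_C b) xyz).
Proof.
pose v := diag_shift (- of_C b) xyz.
have E : diag_shift (of_C b) v = xyz.
  by rewrite /v -[X in diag_shift X]opprK diag_shiftK.
have [_ _ z0] := generic_off_poles 0 0 generic_xyz.
apply: (@generic_extends v) => i; rewrite -{2}E !(tnth_nth 0).
apply: extends_at_diag_shift; try exact: extends_at_C.
- exact: extends_at_coord.
- by rewrite diag_shift2.
- exact: ltn_ord.
Qed.

Lemma map_rsubst_xyz v : generic v -> map_tuple (rsubst v) xyz = v.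
Proof.
by move=> gv; apply: eq_from_tnth => i; rewrite tnth_map rsubst_coord.
Qed.

Lemma map_rsubst_pole_shift v p q a : generic v ->
  map_tuple (rsubst v) (pole_shift (of_C p) (of_C q) (of_C a) xyz)
  = pole_shift (of_C p) (of_C q) (of_C a) v.
Proof.
move=> gv; rewrite (map_pole_shift (subst_morph gv)) -!rsubstE !rsubst_C //.
by rewrite map_rsubst_xyz.
Qed.

Lemma map_rsubst_diag_shift v b : generic v ->
  map_tuple (rsubst v) (diag_shift (of_C b) xyz) = diag_shift (of_C b) v.
Proof.
move=> gv; rewrite (map_diag_shift (subst_morph gv)) -!rsubstE !rsubst_C //.
by rewrite map_rsubst_xyz.
Qed.

Lemma generic_pole_shift p q a v : generic v ->
  generic (pole_shift (of_C p) (of_C q) (of_C a) v).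
Proof.
move=> gv; rewrite -map_rsubst_pole_shift //.
exact/generic_comp/gv/generic_pole_shift_xyz.
Qed.

Lemma generic_diag_shift b v : generic v -> generic (diag_shift (of_C b) v).
Proof.
move=> gv; rewrite -map_rsubst_diag_shift //.
exact/generic_comp/gv/generic_diag_shift_xyz.
Qed.

(** All the intermediate triples are generic, hence off the poles. *)
Lemma generic_braid p q a b v : generic v ->
  let Sh c := pole_shift (of_C p) (of_C q) (of_C c) in
  let Tr c := diag_shift (of_C c) in
  Sh a (Tr (b + 2 * a) (Sh (a + b) (Tr b v)))
  = Tr b (Sh (a + b) (Tr (b + 2 * a) (Sh a v))).
Proof.
move=> gv Sh Tr; have := @shift_braid _ (of_C p) (of_C q) (of_C a) (of_C b) v.
rewrite -(rmorph_nat of_C 2) -rmorphM -!rmorphD.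
apply; apply: generic_off_poles.
- exact: gv.
- exact: generic_diag_shift.
- exact/generic_pole_shift/generic_diag_shift.
- exact: generic_pole_shift.
- exact/generic_diag_shift/generic_pole_shift.
Qed.

(** * Action of transformations on generic triples *)

Definition generic_transf (T : transf R) := forall beta, generic (tvar T beta).

(** The triple is the point at which the variables are evaluated: [s] collects
    the current values of the variables and of the parameters. *)
Definition act (T : transf R) (s : 3.-tuple K * 3.-tuple C) :=
  (map_tuple (rsubst s.1) (tvar T s.2), tpar T s.2).

Lemma generic_act T s : generic_transf T -> generic s.1 -> generic (act T s).1.
Proof. by move=> gT gs; apply: generic_comp. Qed.

Lemma generic_tcomp T S : generic_transf T -> generic_transf S ->
  generic_transf (tcomp T S).
Proof. by move=> gT gS beta; apply: generic_comp. Qed.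

Lemma generic_tid : generic_transf (tid R).
Proof. by move=> beta; apply: generic_xyz. Qed.

Lemma generic_tpow T n : generic_transf T -> generic_transf (tpow T n).
Proof.
move=> gT; elim: n => [|n IH]; first exact: generic_tid.
exact: generic_tcomp.
Qed.

(** Substituting in two steps amounts to substituting the substituted triple. *)
Lemma act_tcomp T S s : generic_transf S -> generic s.1 ->
  act (tcomp T S) s = act T (act S s).
Proof.
move=> gS gs; congr pair; apply: eq_from_tnth => i.
by rewrite !tnth_map rsubst_comp.
Qed.

Lemma act_tid s : generic s.1 -> act (tid R) s = s.
Proof. by case: s => v beta gv; rewrite /act map_rsubst_xyz. Qed.

Lemma act_tpow T n s : generic_transf T -> generic s.1 ->
  act (tpow T n) s = iter n (act T) s.
Proof.
move=> gT gs; elim: n => [|n IH]; first exact: act_tid.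
by rewrite iterS -IH [LHS](act_tcomp _ (generic_tpow n gT) gs).
Qed.

Lemma act_tpow_tcomp T S n s : generic_transf T -> generic_transf S ->
  generic s.1 -> act (tpow (tcomp T S) n) s = iter n (act T \o act S) s.
Proof.
move=> gT gS gs; have gTS := generic_tcomp gT gS.
rewrite (act_tpow n gTS gs); elim: n => // n IH; rewrite !iterS -IH.
rewrite -(act_tpow n gTS gs); apply: act_tcomp => //.
exact: generic_act (generic_tpow n gTS) gs.
Qed.

(** Acting on the coordinates returns the transformation itself. *)
Lemma teq_act T S :
  (forall beta, act T (xyz, beta) = act S (xyz, beta)) -> teq T S.
Proof.
move=> TS beta _; have := TS beta; rewrite /act /=.
have mapid w : map_tuple (rsubst xyz) w = w.
  by apply: eq_from_tnth => i; rewrite tnth_map rsubst_id.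
by rewrite !mapid => -[].
Qed.

Lemma teq_tid T : (forall s, generic s.1 -> act T s = s) -> teq T (tid R).
Proof.
move=> T1; apply: teq_act => beta.
by rewrite T1 ?act_tid //; apply: generic_xyz.
Qed.

Definition act_involutive T := forall s, generic s.1 -> act T (act T s) = s.

Lemma teq_involution T : generic_transf T -> act_involutive T ->
  teq (tcomp T T) (tid R).
Proof. by move=> gT TT; apply: teq_tid => s gs; rewrite act_tcomp // TT. Qed.

Lemma teq_tpow2 T : generic_transf T -> act_involutive T ->
  teq (tpow T 2) (tid R).
Proof.
by move=> gT TT; apply: teq_tid => s gs; rewrite (act_tpow 2 gT gs) /= TT.
Qed.

Lemma teq_commute T S : generic_transf T -> generic_transf S ->
  act_involutive T -> act_involutive S ->
  (forall s, generic s.1 -> act T (act S s) = act S (act T s)) ->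
  teq (tpow (tcomp T S) 2) (tid R).
Proof.
move=> gT gS TT SS TS; apply: teq_tid => s gs.
rewrite (act_tpow_tcomp _ gT gS gs).
by apply: (@iter2_commute _ (fun s => generic s.1)) => // s' gs';
  exact: generic_act.
Qed.

Lemma teq_braid T S : generic_transf T -> generic_transf S ->
  act_involutive T -> act_involutive S ->
  (forall s, generic s.1 ->
     act T (act S (act T (act S s))) = act S (act T (act S (act T s)))) ->
  teq (tpow (tcomp T S) 4) (tid R).
Proof.
move=> gT gS TT SS TS; apply: teq_tid => s gs.
rewrite (act_tpow_tcomp _ gT gS gs).
by apply: (@iter4_braid _ (fun s => generic s.1)) => // s' gs';
  exact: generic_act.
Qed.

(** * Rational dependence on the variables and parameters *)

Definition eval_at beta : {rmorphism {mpoly Ct[3 + 3]} -> K} :=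
  mmap of_Ct (tnth (cat_tuple xyz (map_tuple of_C beta))).

Local Notation rat := (@rational_in_xyz_beta R).

Lemma ratP f : rat f <-> exists n d : {mpoly Ct[3 + 3]}, forall beta,
  is_param beta ->
  eval_at beta d != 0 /\ f beta = eval_at beta n / eval_at beta d.
Proof. by []. Qed.

Lemma rat_poly (p : {mpoly Ct[3 + 3]}) f :
  (forall beta, f beta = eval_at beta p) -> rat f.
Proof.
move=> fp; apply/ratP; exists p, 1 => beta _.
by rewrite rmorph1 oner_neq0 divr1.
Qed.

Lemma rat_coord k : (k < 3)%N -> rat (fun=> xyz`_k).
Proof.
move=> k3; apply: (@rat_poly 'X_(lshift 3 (Ordinal k3))) => beta.
by rewrite /eval_at /= mmapX mmap1U tnth_lshift (tnth_nth 0).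
Qed.

Lemma rat_param k : (k < 3)%N -> rat (fun beta => of_C beta`_k).
Proof.
move=> k3; apply: (@rat_poly 'X_(rshift 3 (Ordinal k3))) => beta.
by rewrite /eval_at /= mmapX mmap1U tnth_rshift tnth_map (tnth_nth 0).
Qed.

Lemma rat_const c : rat (fun=> of_C c).
Proof.
by apply: (@rat_poly (Ct_const c)%:MP) => beta; rewrite /eval_at /= mmapC.
Qed.

Lemma ratD f g : rat f -> rat g -> rat (fun beta => f beta + g beta).
Proof.
move=> /ratP[n [d fE]] /ratP[n' [d' gE]]; apply/ratP.
exists (n * d' + n' * d), (d * d') => beta pb.
have [[d0 ->] [d0' ->]] := (fE beta pb, gE beta pb).
exact: (rmorph_fracD n n' d0 d0').
Qed.

Lemma ratN f : rat f -> rat (fun beta => - f beta).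
Proof.
move=> /ratP[n [d fE]]; apply/ratP; exists (- n), d => beta pb.
by have [d0 ->] := fE beta pb; rewrite rmorphN mulNr.
Qed.

Lemma ratM f g : rat f -> rat g -> rat (fun beta => f beta * g beta).
Proof.
move=> /ratP[n [d fE]] /ratP[n' [d' gE]]; apply/ratP.
exists (n * n'), (d * d') => beta pb.
have [[d0 ->] [d0' ->]] := (fE beta pb, gE beta pb).
exact: (rmorph_fracM n n' d0 d0').
Qed.

Lemma ratV f : (forall beta, f beta != 0) -> rat f ->
  rat (fun beta => (f beta)^-1).
Proof.
move=> f0 /ratP[n [d fE]]; apply/ratP; exists d, n => beta pb.
have [d0 fb] := fE beta pb; have := f0 beta; rewrite fb.
exact: (@rmorph_fracV _ _ (eval_at beta)).
Qed.

Lemma rat_pole_shift p q k i : (k < 3)%N ->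
  rat (fun beta => tnth (pole_shift (of_C p) (of_C q) (of_C beta`_k) xyz) i).
Proof.
move=> k3; have [x0 y0 _] := generic_off_poles p q generic_xyz.
have rB f c : rat f -> rat (fun beta => f beta - of_C c).
  by move=> rf; apply: ratD rf (ratN (rat_const c)).
case: i => [[|[|[|//]]] i].
- exact: (rat_coord (k := 0)).
- exact: (rat_coord (k := 1)).
have [rx [ry rz]] :=
  conj (@rat_coord 0 isT) (conj (@rat_coord 1 isT) (@rat_coord 2 isT)).
have rden := ratM (rB _ p rx) (rB _ q ry).
have rnum := ratM (rat_param k3) (rB _ q (rB _ p (ratD rx ry))).
exact: (ratD rz (ratN (ratM rnum (ratV (fun=> mulf_neq0 x0 y0) rden)))).
Qed.

Lemma rat_diag_shift k i : (k < 3)%N ->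
  rat (fun beta => tnth (diag_shift (of_C beta`_k) xyz) i).
Proof.
move=> k3; have [_ _ z0] := generic_off_poles 0 0 generic_xyz.
have rbz : rat (fun beta => of_C beta`_k / xyz`_2).
  exact: (ratM (rat_param k3) (ratV (fun=> z0) (@rat_coord 2 isT))).
case: i => [[|[|[|//]]] i].
- exact: (ratD (@rat_coord 0 isT) rbz).
- exact: (ratD (@rat_coord 1 isT) rbz).
- exact: (rat_coord (k := 2)).
Qed.

Lemma rational_of_polynomial (f : 3.-tuple C -> C) (p : {mpoly C[3]}) :
  (forall beta, f beta = p.@[tnth beta]) -> rational_in_beta f.
Proof. by move=> fp; exists p, 1 => beta _; rewrite meval1 oner_neq0 divr1. Qed.

(** An involution is its own inverse. *)
Lemma birational_involution (T : transf R) :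
  rational_transf T -> generic_transf T -> act_involutive T ->
  birational_transf T.
Proof.
by move=> rT gT TT; split=> //; exists T; split=> //; apply: teq_involution.
Qed.

(** * Relations between the reflections *)

Variable eta : C.
Local Notation s0 := (s0 eta).
Local Notation s1 := (s1 R).
Local Notation s2 := (s2 R).

Lemma tvar_s0 beta : tvar s0 beta
  = pole_shift (of_C eta) (of_C 1) (of_C beta`_0) xyz.
Proof. by rewrite rmorph1. Qed.

Lemma tvar_s2 beta : tvar s2 beta
  = pole_shift (of_C 0) (of_C 0) (of_C beta`_2) xyz.
Proof. by rewrite rmorph0 /pole_shift !subr0. Qed.

Lemma generic_s0 : generic_transf s0.
Proof. by move=> beta; rewrite tvar_s0; apply: generic_pole_shift_xyz. Qed.
Lemma generic_s1 : generic_transf s1.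
Proof. by move=> beta; apply: generic_diag_shift_xyz. Qed.
Lemma generic_s2 : generic_transf s2.
Proof. by move=> beta; rewrite tvar_s2; apply: generic_pole_shift_xyz. Qed.

Lemma act_s0 b0 b1 b2 v : generic v -> act s0 (v, [tuple b0; b1; b2]) =
  (pole_shift (of_C eta) (of_C 1) (of_C b0) v, [tuple - b0; b1 + 2 * b0; b2]).
Proof. by move=> gv; rewrite /act tvar_s0 map_rsubst_pole_shift. Qed.

Lemma act_s1 b0 b1 b2 v : generic v -> act s1 (v, [tuple b0; b1; b2]) =
  (diag_shift (of_C b1) v, [tuple b0 + b1; - b1; b2 + b1]).
Proof. by move=> gv; rewrite /act map_rsubst_diag_shift. Qed.

Lemma act_s2 b0 b1 b2 v : generic v -> act s2 (v, [tuple b0; b1; b2]) =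
  (pole_shift (of_C 0) (of_C 0) (of_C b2) v, [tuple b0; b1 + 2 * b2; - b2]).
Proof. by move=> gv; rewrite /act tvar_s2 map_rsubst_pole_shift. Qed.

Lemma s0_involutive : act_involutive s0.
Proof.
case=> v beta /= gv; have [b0 [b1 [b2 ->]]] := tuple3P beta.
rewrite (act_s0 _ _ _ gv) (act_s0 _ _ _ (generic_pole_shift _ _ _ gv)) /=.
rewrite rmorphN pole_shiftK.
by congr pair; apply/val_inj; congr [:: _; _; _] => /=; ring.
Qed.

Lemma s1_involutive : act_involutive s1.
Proof.
case=> v beta /= gv; have [b0 [b1 [b2 ->]]] := tuple3P beta.
rewrite (act_s1 _ _ _ gv) (act_s1 _ _ _ (generic_diag_shift _ gv)) /=.
rewrite rmorphN diag_shiftK.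
by congr pair; apply/val_inj; congr [:: _; _; _] => /=; ring.
Qed.

Lemma s2_involutive : act_involutive s2.
Proof.
case=> v beta /= gv; have [b0 [b1 [b2 ->]]] := tuple3P beta.
rewrite (act_s2 _ _ _ gv) (act_s2 _ _ _ (generic_pole_shift _ _ _ gv)) /=.
rewrite rmorphN pole_shiftK.
by congr pair; apply/val_inj; congr [:: _; _; _] => /=; ring.
Qed.

Lemma s0s2_commute s : generic s.1 -> act s0 (act s2 s) = act s2 (act s0 s).
Proof.
case: s => v beta /= gv; have [b0 [b1 [b2 ->]]] := tuple3P beta.
have gS p q a w := @generic_pole_shift p q a w.
rewrite (act_s2 _ _ _ gv) (act_s0 _ _ _ gv) (act_s0 _ _ _ (gS _ _ _ _ gv)).
rewrite (act_s2 _ _ _ (gS _ _ _ _ gv)) /= pole_shiftC.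
by congr pair; apply/val_inj; congr [:: _; _; _] => /=; ring.
Qed.

(** The parameters met along the two words are those of the braid relation, with
    a = b_0 and b = b_1. *)
Lemma s0s1_braid s : generic s.1 ->
  act s0 (act s1 (act s0 (act s1 s))) = act s1 (act s0 (act s1 (act s0 s))).
Proof.
case: s => v beta /= gv; have [b0 [b1 [b2 ->]]] := tuple3P beta.
have gS p q a w := @generic_pole_shift p q a w.
have gT b w := @generic_diag_shift b w.
rewrite (act_s1 _ _ _ gv) (act_s0 _ _ _ (gT _ _ gv)).
rewrite (act_s1 _ _ _ (gS _ _ _ _ (gT _ _ gv))).
rewrite (act_s0 _ _ _ (gT _ _ (gS _ _ _ _ (gT _ _ gv)))).
rewrite (act_s0 _ _ _ gv) (act_s1 _ _ _ (gS _ _ _ _ gv)).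
rewrite (act_s0 _ _ _ (gT _ _ (gS _ _ _ _ gv))).
rewrite (act_s1 _ _ _ (gS _ _ _ _ (gT _ _ (gS _ _ _ _ gv)))) /=.
have -> : - b1 + 2 * (b0 + b1) = b1 + 2 * b0 by ring.
have -> : - (b0 + b1) + (b1 + 2 * b0) = b0 by ring.
have -> : - b0 + (b1 + 2 * b0) = b0 + b1 by ring.
have -> : - (b1 + 2 * b0) + 2 * (b0 + b1) = b1 by ring.
rewrite generic_braid //.
by congr pair; apply/val_inj; congr [:: _; _; _] => /=; ring.
Qed.

(** As for [s0s1_braid], with a = b_2. *)
Lemma s2s1_braid s : generic s.1 ->
  act s2 (act s1 (act s2 (act s1 s))) = act s1 (act s2 (act s1 (act s2 s))).
Proof.
case: s => v beta /= gv; have [b0 [b1 [b2 ->]]] := tuple3P beta.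
have gS p q a w := @generic_pole_shift p q a w.
have gT b w := @generic_diag_shift b w.
rewrite (act_s1 _ _ _ gv) (act_s2 _ _ _ (gT _ _ gv)).
rewrite (act_s1 _ _ _ (gS _ _ _ _ (gT _ _ gv))).
rewrite (act_s2 _ _ _ (gT _ _ (gS _ _ _ _ (gT _ _ gv)))).
rewrite (act_s2 _ _ _ gv) (act_s1 _ _ _ (gS _ _ _ _ gv)).
rewrite (act_s2 _ _ _ (gT _ _ (gS _ _ _ _ gv))).
rewrite (act_s1 _ _ _ (gS _ _ _ _ (gT _ _ (gS _ _ _ _ gv)))) /=.
have -> : - b1 + 2 * (b2 + b1) = b1 + 2 * b2 by ring.
have -> : - (b2 + b1) + (b1 + 2 * b2) = b2 by ring.
have -> : - b2 + (b1 + 2 * b2) = b2 + b1 by ring.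
have -> : - (b1 + 2 * b2) + 2 * (b2 + b1) = b1 by ring.
rewrite generic_braid //.
by congr pair; apply/val_inj; congr [:: _; _; _] => /=; ring.
Qed.

Lemma relations_s : affine_Weyl_D32_relations s0 s1 s2.
Proof.
have [g0 [g1 g2]] := (conj generic_s0 (conj generic_s1 generic_s2)).
have [i0 [i1 i2]] := (conj s0_involutive (conj s1_involutive s2_involutive)).
split; first by split; apply: teq_tpow2.
- exact: (teq_braid g0 g1 i0 i1 s0s1_braid).
- by apply: (teq_braid g1 g2 i1 i2) => s gs; rewrite s2s1_braid.
- exact: (teq_commute g0 g2 i0 i2 s0s2_commute).
Qed.

(** * The reflections as symmetries of the system *)

Lemma rational_s0 : rational_transf s0.
Proof.
split=> [i|i|beta].
- have [p [q E]] := @rat_pole_shift eta 1 0 i isT.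
  by exists p, q => beta /E; rewrite tvar_s0.
- case: i => [[|[|[|//]]] i].
  + apply: (@rational_of_polynomial _ (- 'X_0)) => beta.
    by rewrite mevalN mevalXU !(tnth_nth 0).
  + apply: (@rational_of_polynomial _ ('X_1 + 2 * 'X_0)) => beta.
    by rewrite mevalD mevalM rmorph_nat !mevalXU !(tnth_nth 0).
  + apply: (@rational_of_polynomial _ 'X_2) => beta.
    by rewrite mevalXU !(tnth_nth 0).
- by rewrite /is_param /= => <-; ring.
Qed.

Lemma rational_s1 : rational_transf s1.
Proof.
split=> [i|i|beta].
- exact: (@rat_diag_shift 1 i isT).
- case: i => [[|[|[|//]]] i].
  + apply: (@rational_of_polynomial _ ('X_0 + 'X_1)) => beta.
    by rewrite mevalD !mevalXU !(tnth_nth 0).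
  + apply: (@rational_of_polynomial _ (- 'X_1)) => beta.
    by rewrite mevalN mevalXU !(tnth_nth 0).
  + apply: (@rational_of_polynomial _ ('X_2 + 'X_1)) => beta.
    by rewrite mevalD !mevalXU !(tnth_nth 0).
- by rewrite /is_param /= => <-; ring.
Qed.

Lemma rational_s2 : rational_transf s2.
Proof.
split=> [i|i|beta].
- have [p [q E]] := @rat_pole_shift 0 0 2 i isT.
  by exists p, q => beta /E; rewrite tvar_s2.
- case: i => [[|[|[|//]]] i].
  + apply: (@rational_of_polynomial _ 'X_0) => beta.
    by rewrite mevalXU !(tnth_nth 0).
  + apply: (@rational_of_polynomial _ ('X_1 + 2 * 'X_2)) => beta.
    by rewrite mevalD mevalM rmorph_nat !mevalXU !(tnth_nth 0).
  + apply: (@rational_of_polynomial _ (- 'X_2)) => beta.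
    by rewrite mevalN mevalXU !(tnth_nth 0).
- by rewrite /is_param /= => <-; ring.
Qed.

Variable b : Ct.
Hypotheses (eta_neq0 : eta != 0) (b_neq0 : b != 0).

Lemma two_neq0 : (2 : K) != 0.
Proof. by rewrite -(rmorph_nat of_C 2) fmorph_eq0 pnatr_eq0. Qed.

Lemma alpha_of_beta_map beta :
  map_tuple of_C (alpha_of_beta beta) = alpha_of_beta (map_tuple of_C beta).
Proof. by have [b0 [b1 [b2 ->]]] := tuple3P beta; apply: val_inj. Qed.

(** The constant factor of [flow] is the inverse of the one in the system. *)
Lemma flow_solution beta : beta_system eta b beta (flow eta b beta) xyz.
Proof.
have k0 : 2 * of_C eta / of_Ct b != 0.
  by rewrite !mulf_neq0 ?invr_eq0 ?fmorph_eq0 ?two_neq0.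
have H k (k3 : (k < 3)%N) v : total_deriv v xyz`_k = v`_k.
  by rewrite -!(tnth_nth 0 _ (Ordinal k3)) total_deriv_coord.
rewrite /beta_system /flow /D4_system !H // -(invf_div (2 * _)) /=.
by split; rewrite ?mulrNN ?mulVKf.
Qed.

Lemma param_of_C beta : is_param beta -> is_param (map_tuple of_C beta).
Proof.
have [b0 [b1 [b2 ->]]] := tuple3P beta; rewrite /is_param /= => h.
by rewrite -!rmorphD h fmorphV rmorph_nat.
Qed.

Lemma flow_derivation beta : derivation_along id (flow eta b beta).
Proof. exact: total_deriv_derivation. Qed.

Lemma flow_const beta c : flow eta b beta (of_C c) = 0.
Proof. exact: total_deriv_const. Qed.

Lemma flow_param beta i : flow eta b beta (tnth (map_tuple of_C beta) i) = 0.
Proof. by rewrite tnth_map flow_const. Qed.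

Lemma beta_systemE beta D u : beta_system eta b beta D u =
  D4_system D (of_Ct b) (of_C eta) (alpha_of_beta (map_tuple of_C beta)) u.
Proof. by rewrite /beta_system alpha_of_beta_map. Qed.

Lemma beta_system_s0 beta : is_param beta ->
  beta_system eta b (tpar s0 beta) (flow eta b beta) (tvar s0 beta).
Proof.
move=> pb; have [x0 y0 _] := generic_off_poles eta 1 generic_xyz.
have := flow_solution beta; rewrite tvar_s0 !beta_systemE rmorph1 => sol.
rewrite rmorph1 in y0.
have := D4_system_s0 (flow_derivation beta) two_neq0 (param_of_C pb)
  (flow_const beta eta) (flow_param beta) x0 y0 sol.
have [b0 [b1 [b2 ->]]] := tuple3P beta.
have -> : map_tuple of_C (tpar s0 [tuple b0; b1; b2])
    = [tuple - of_C b0; of_C b1 + 2 * of_C b0; of_C b2].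
  apply/val_inj; congr [:: _; _; _]; first exact: rmorphN.
  by rewrite /= rmorphD rmorphM rmorph_nat.
by [].
Qed.

Lemma beta_system_s1 beta : is_param beta ->
  beta_system eta b (tpar s1 beta) (flow eta b beta) (tvar s1 beta).
Proof.
move=> pb; have [_ _ z0] := generic_off_poles 0 0 generic_xyz.
have := flow_solution beta; rewrite !beta_systemE => sol.
have := D4_system_s1 (flow_derivation beta) two_neq0 (param_of_C pb)
  (flow_param beta) z0 sol.
have [b0 [b1 [b2 ->]]] := tuple3P beta.
have -> : map_tuple of_C (tpar s1 [tuple b0; b1; b2])
    = [tuple of_C b0 + of_C b1; - of_C b1; of_C b2 + of_C b1].
  by apply/val_inj; congr [:: _; _; _]; rewrite /= ?rmorphN ?rmorphD.
by [].
Qed.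

Lemma beta_system_s2 beta : is_param beta ->
  beta_system eta b (tpar s2 beta) (flow eta b beta) (tvar s2 beta).
Proof.
move=> pb; have [x0 y0 _] := generic_off_poles 0 0 generic_xyz.
have := flow_solution beta; rewrite tvar_s2 !beta_systemE rmorph0 => sol.
rewrite rmorph0 !subr0 in x0 y0.
have := D4_system_s2 (flow_derivation beta) two_neq0 (param_of_C pb)
  (flow_param beta) x0 y0 sol.
have [b0 [b1 [b2 ->]]] := tuple3P beta.
have -> : map_tuple of_C (tpar s2 [tuple b0; b1; b2])
    = [tuple of_C b0; of_C b1 + 2 * of_C b2; - of_C b2].
  apply/val_inj; congr [:: _; _; _]; last exact: rmorphN.
  by rewrite /= rmorphD rmorphM rmorph_nat.
by [].
Qed.
End RationalFunctions.

Theorem theorem5p2 (R : realType) (eta : R[i]) (b : Ct R)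
    (eta_neq0 : eta != 0) (b_neq0 : b != 0) :
  [/\ Backlund eta b (s0 eta), Backlund eta b (s1 R) & Backlund eta b (s2 R)]
  /\ affine_Weyl_D32_relations (s0 eta) (s1 R) (s2 R).
Proof.
split; last exact: relations_s.
split; split.
- apply: (birational_involution (rational_s0 eta) (@generic_s0 _ eta)).
  exact: s0_involutive.
- by move=> beta pb; apply: beta_system_s0.
- apply: (birational_involution (rational_s1 R) (@generic_s1 R)).
  exact: s1_involutive.
- by move=> beta pb; apply: beta_system_s1.
- apply: (birational_involution (rational_s2 R) (@generic_s2 R)).
  exact: s2_involutive.
- by move=> beta pb; apply: beta_system_s2.
Qed.
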